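(* Let $n\ge 2$. The mapping $\Phi$ is an involution on $D_n$, and for any $w\in D_n$ we have $$\rho(w)=\mathrm{area}(\Phi(w))\qquad\text{and}\qquad \mathrm{dinv}(w)=\mathrm{dinv}(\Phi(w)),$$ where $\rho(w)$ denotes the prerank of $w$.
   Context: Words are over $\{a,b\}$; $|u|_a,|u|_b$ are letter counts and $\delta(u)=|u|_a-|u|_b$. A Dyck word is a word $w$ with $|w|_a=|w|_b$ and $\delta(u)\ge0$ for every prefix $u$. $D_n$ is the set of words with $n-1$ letters $a$ and $n$ letters $b$ with $\delta(u)\ge 0$ for every strict prefix $u$; equivalently $w\in D_n$ iff $w=w'b$ with $w'$ a Dyck word having $n-1$ letters $a$. Heights: for a word $w$, $\eta_i=\delta(w^{(i)})$, where $w^{(i)}$ is the prefix of $w$ immediately preceding the $i$-th occurrence of $a$. For $w\in D_n$ with heights $\eta_1,\ldots,\eta_{n-1}$: $\mathrm{area}(w)=\sum_{i=1}^{n-1}\eta_i$, and $\mathrm{dinv}(w)$ is the number of pairs $(i,j)$ with $i<j$ and ($\eta_i=\eta_j$ or $\eta_j=\eta_i-1$). Prerank: every non-empty Dyck word has a unique first-return decomposition $aubv$ with $u,v$ Dyck words (possibly empty); set $\theta(aubv)=vabu$. The prerank of a Dyck word $w'$ of length $2p$ is the smallest $k\ge 0$ such that $\theta^k(w')=(ab)^p$. For $w=w'b\in D_n$, the prerank $\rho(w)$ is defined to be the prerank of $w'$. The map $\Phi$: for $w\in D_n$ with heights $\eta_1,\ldots,\eta_{n-1}$, let $m$ be the largest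 index such that $\eta_m$ is maximal among the $\eta_i$; write $w=uv$ where $u$ is the prefix of $w$ ending with the $m$-th occurrence of $a$. Then $\Phi(w)=\tilde u\,\tilde v$, where $\tilde{x}$ denotes the word $x$ written from right to left. One has $\Phi(w)\in D_n$. *)

(* Defs.v *)
From mathcomp Require Import all_boot all_order all_algebra.

Set Implicit Arguments.
Unset Strict Implicit.
Unset Printing Implicit Defensive.

Import Order.TTheory GRing.Theory Num.Theory.

Local Open Scope ring_scope.

(* Words over {a, b} are sequences of booleans: a is true, b is false. *)
Definition word := seq bool.

Notation la := true (only parsing).
Notation lb := false (only parsing).

Definition delta (u : word) : int :=
  (count_mem la u)%:Z - (count_mem lb u)%:Z.

Definition dyck (w : word) : bool :=
  (count_mem la w == count_mem lb w) &&
  [forall k : 'I_(size w).+1, 0 <= delta (take k w)].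

(* The set D_n. Since n.-1 is 0 for n = 0, it is only meaningful for n > 0. *)
Definition D (n : nat) : pred word :=
  [pred w | [&& count_mem la w == n.-1,
                count_mem lb w == n &
                [forall k : 'I_(size w), 0 <= delta (take k w)]]].

(* 0-based positions of the occurrences of a, so that the prefix preceding an
   occurrence at position k is take k w and the prefix ending with it is
   take k.+1 w. *)
Definition apos (w : word) : seq nat :=
  [seq k <- iota 0 (size w) | nth lb w k == la].

(* nth 0 (heights w) i is eta_(i+1): heights are indexed from 0. *)
Definition heights (w : word) : seq int := [seq delta (take k w) | k <- apos w].

Definition area (w : word) : int := \sum_(h <- heights w) h.

Definition dinv (w : word) : nat :=
  let s := heights w in
  #|[set ij : 'I_(size s) * 'I_(size s) |
      (ij.1 < ij.2)%N &&
      ((s`_ij.1 == s`_ij.2) || (s`_ij.2 == s`_ij.1 - 1))]|.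

(* aubv |-> vabu, where aubv is the first-return decomposition; k is the length
   of u. Words without such a decomposition (e.g. the empty one) are fixed. *)
Definition theta (w : word) : word :=
  let u k := take k (behead w) in
  let v k := drop k.+1 (behead w) in
  if [pick k : 'I_(size w) |
        [&& dyck (u k), dyck (v k) & w == la :: u k ++ lb :: v k]] is Some k
  then v k ++ [:: la; lb] ++ u k
  else w.

Definition abpow (p : nat) : word := flatten (nseq p [:: la; lb]).

(* "The prerank of the Dyck word w is k". This is a relation so that the
   existence of such a k is not built in through a default value. *)
Definition dyck_prerank (w : word) (k : nat) : Prop :=
  iter k theta w = abpow (size w)./2 /\
  (forall j : nat, iter j theta w = abpow (size w)./2 -> (k <= j)%N).

(* "rho(w) = k" for w in D_n. *)
Definition prerank (w : word) (k : nat) : Prop :=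
  exists w' : word, w = rcons w' lb /\ dyck_prerank w' k.

(* m is the largest (0-based) index at which the height is maximal; it exists
   as soon as w contains an a. The default is irrelevant otherwise. *)
Definition Phi (w : word) : word :=
  let s := heights w in
  if [pick m : 'I_(size s) |
        [forall j : 'I_(size s),
           (s`_j <= s`_m) && ((m < j)%N ==> (s`_j < s`_m))]] is Some m
  then let k := (nth 0%N (apos w) m).+1 in rev (take k w) ++ rev (drop k w)
  else w.

(* Main.v *)
(** Let [h] be the maximal height of [w], last attained at the [m]-th [a]. Then
    [Phi] replaces the heights before and at [m] by [h - eta_i], the later ones
    by [h - 1 - eta_i], and reverses both blocks. This map is an involution, and
    it exchanges the two conditions in the definition of dinv for pairs taken
    in different blocks. The area of [Phi w] is therefore
    [\sum_(i <= m) (h - eta_i) + \sum_(i > m) (h - 1 - eta_i)]. This potential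
    vanishes exactly on [(ab)^p] and otherwise drops by one under [theta], which
    turns the heights [0, 1 + eta(u), eta(v)] into [eta(v), 0, eta(u)]. *)
Require Import Defs.
From mathcomp Require Import all_boot all_order all_algebra.
From mathcomp Require Import zify ring.

Set Implicit Arguments.
Unset Strict Implicit.
Unset Printing Implicit Defensive.

Import Order.TTheory GRing.Theory Num.Theory.

Local Open Scope ring_scope.

(** * Letter balance under concatenation and reversal *)

Lemma delta_nil : delta [::] = 0. Proof. by []. Qed.

Lemma delta_cat u v : delta (u ++ v) = delta u + delta v.
Proof. by rewrite /delta !count_cat; lia. Qed.

Lemma delta_cons x u : delta (x :: u) = (if x then 1 else -1) + delta u.
Proof. by case: x; rewrite /delta /=; lia. Qed.

Lemma delta_rev u : delta (rev u) = delta u.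
Proof. by rewrite /delta !count_rev. Qed.

Lemma add_delta_cons c x u :
  c + delta (x :: u) = c + (if x then 1 else -1) + delta u.
Proof. by rewrite delta_cons addrA. Qed.

Lemma delta_take_rev k w :
  delta (take k (rev w)) = delta w - delta (take (size w - k) w).
Proof.
have := delta_cat (take (size w - k) w) (drop (size w - k) w).
by rewrite cat_take_drop take_rev delta_rev => ->; rewrite addrC addKr.
Qed.

Definition deltaE := (delta_cat, delta_cons, delta_nil).

(** ** Heights *)

(* Heights of [w] as a path started at level [c]. *)
Fixpoint hts (c : int) (w : word) : seq int :=
  if w is x :: w' then if x then c :: hts (c + 1) w' else hts (c - 1) w'
  else [::].

Lemma hts_cat c u v : hts c (u ++ v) = hts c u ++ hts (c + delta u) v.
Proof.
elim: u c => [|[] u IH] c; first by rewrite delta_nil addr0.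
- by rewrite /= IH add_delta_cons.
- by rewrite /= IH add_delta_cons.
Qed.

Lemma size_hts c w : size (hts c w) = count_mem true w.
Proof. by elim: w c => [|[] w IH] c //=; rewrite IH. Qed.

Lemma hts_shift c d w : hts (c + d) w = [seq y + d | y <- hts c w].
Proof.
elim: w c => [|[] w IH] c //=; last by rewrite -IH addrAC.
by rewrite -IH addrAC.
Qed.

(** An [a] at height [y] in [w = p a s] is preceded in [rev w] by [rev s], and
    [delta s = delta w - 1 - (y - c)]. *)
Lemma hts_rev c w :
  hts c (rev w) = rev [seq 2 * c + delta w - 1 - y | y <- hts c w].
Proof.
elim: w c => [|x w IH] c //.
rewrite rev_cons -cats1 hts_cat IH delta_rev delta_cons.
case: x => /=.
- rewrite (hts_shift c 1) -map_comp rev_cons -cats1; congr (rev _ ++ [:: _]).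
    by apply: eq_map => y /=; ring.
  by ring.
- rewrite cats0 (hts_shift c (-1)) -map_comp; congr (rev _).
  by apply: eq_map => y /=; ring.
Qed.

Lemma apos_cons x w :
  apos (x :: w) = (if x then [:: 0%N] else [::]) ++ [seq k.+1 | k <- apos w].
Proof.
rewrite /apos /= -add1n iotaDl filter_map.
have -> : [seq i <- iota 0 (size w) |
             preim (addn 1) (fun k => nth false (x :: w) k == true) i] = apos w.
  by apply: eq_filter => k.
by case: x.
Qed.

Lemma apos_cat u v : apos (u ++ v) = apos u ++ [seq (size u + k)%N | k <- apos v].
Proof.
elim: u => [|x u IH]; first by rewrite map_id_in.
rewrite cat_cons !apos_cons IH map_cat -map_comp catA.
by congr (_ ++ _); apply: eq_map => k /=; rewrite addSn.
Qed.

Lemma heightsE w : heights w = hts 0 w.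
Proof.
(* The start level 0 is made explicit so that the induction can vary it. *)
rewrite /heights -[LHS](_ : [seq 0 + delta (take k w) | k <- apos w] = _).
  elim: w (0 : int) => [|x w IH] c //.
  rewrite apos_cons map_cat -map_comp.
  have -> : [seq ((fun k => c + delta (take k (x :: w))) \o S) i | i <- apos w]
          = hts (c + (if x then 1 else -1)) w.
    by rewrite -IH; apply: eq_map => k /=; rewrite add_delta_cons.
  by case: x => //=; rewrite delta_nil addr0.
by apply: eq_map => k; rewrite add0r.
Qed.

Lemma size_apos w : size (apos w) = size (hts 0 w).
Proof. by rewrite -heightsE size_map. Qed.

(** The path rises only by an [a], which starts at a level below [b] and so ends at most at [b]. *)
Lemma delta_le_hts c b w :
  c <= b -> all (fun y => y < b) (hts c w) ->
  forall k, c + delta (take k w) <= b.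
Proof.
elim: w c => [|[] w IH] c cb /=; first by move=> _ k; rewrite delta_nil addr0.
- case/andP=> c1 hw [|k] /=; first by rewrite delta_nil addr0.
  rewrite add_delta_cons; apply: IH => //; lia.
- move=> hw [|k] /=; first by rewrite delta_nil addr0.
  rewrite add_delta_cons; apply: IH => //; lia.
Qed.

(** Only strict prefixes are constrained, so that this serves words of [D n] as well as Dyck
    words. *)
Lemma hts_ge0 c w :
  (forall k, (k < size w)%N -> 0 <= c + delta (take k w)) ->
  all (fun y => 0 <= y) (hts c w).
Proof.
elim: w c => [|x w IH] c //= H.
have c0 : 0 <= c by have := H 0%N isT; rewrite delta_nil addr0.
have Hw d : (if x then 1 else -1) = d -> all (fun y => 0 <= y) (hts (c + d) w).
  move=> dE; apply: IH => k kw.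
  by have := H k.+1 kw; rewrite /= delta_cons dE addrA.
by case: x Hw {H} => Hw /=; rewrite ?c0 /= Hw.
Qed.

(** * Dyck words and the sets [D n] in terms of balance *)

Lemma dyckP w :
  reflect (delta w = 0 /\ forall k, 0 <= delta (take k w)) (dyck w).
Proof.
apply: (iffP andP) => [[/eqP e /forallP H]|[e H]].
  have d0 : delta w = 0 by rewrite /delta e subrr.
  split=> // k; case: (leqP k (size w)) => kw; first exact: (H (Ordinal (kw : k < _.+1)%N)).
  by rewrite take_oversize ?d0 // ltnW.
split; last by apply/forallP => k.
by move: e; rewrite /delta; lia.
Qed.

Lemma dyck_cat u v : dyck u -> dyck v -> dyck (u ++ v).
Proof.
move=> /dyckP[u0 pu] /dyckP[v0 pv]; apply/dyckP; rewrite delta_cat u0 v0; split=> // k.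
by rewrite take_cat; case: ifP => _ //; rewrite delta_cat u0 add0r.
Qed.

Lemma dyck_hts_ge0 w : dyck w -> all (fun y => 0 <= y) (hts 0 w).
Proof. by case/dyckP=> _ H; apply: hts_ge0 => k _; rewrite add0r. Qed.

Lemma dyck_hts_nil w : dyck w -> hts 0 w = [::] -> w = [::].
Proof.
case: w => [|[] w] //= /dyckP[_ /(_ 1%N)] /=.
by rewrite take0 delta_cons.
Qed.

Lemma D_P n w : (0 < n)%N ->
  reflect [/\ delta w = -1, count_mem true w = n.-1 &
             forall k, (k < size w)%N -> 0 <= delta (take k w)] (w \in D n).
Proof.
move=> n0; apply: (iffP and3P) => [[/eqP a /eqP b /forallP H]|[d a H]]; split.
- rewrite /delta a b; lia.
- exact: a.
- by move=> k kw; apply: (H (Ordinal kw)).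
- exact/eqP.
- apply/eqP; move: d; rewrite /delta a; lia.
- by apply/forallP=> k; apply: H.
Qed.

Lemma D_rcons n w : (0 < n)%N -> w \in D n ->
  exists2 w', w = rcons w' false & dyck w'.
Proof.
move=> n0 /(D_P _ n0)[d _ H].
case/lastP: w d H => [|w x] //; rewrite -cats1 !deltaE addr0 => d H.
have Hw : 0 <= delta w.
  by have := H (size w); rewrite size_cat addn1 ltnSn take_size_cat //; apply.
case: x d {H} (H) => d H; first lia.
exists w; first by rewrite cats1.
apply/dyckP; split; first lia.
move=> k; case: (ltnP k (size w)) => kw; last by rewrite take_oversize.
have := H k; rewrite size_cat addn1 take_cat kw; apply; exact: leqW.
Qed.

(** ** First-return decomposition *)

Lemma first_return w : dyck w -> w != [::] ->
  exists u v, [/\ w = true :: u ++ false :: v, dyck u & dyck v].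
Proof.
case: w => [|x w] // /dyckP[d H] _.
case: x d H => d H; last by have := H 1%N; rewrite /= take0 delta_cons.
rewrite delta_cons in d.
have Hw k : -1 <= delta (take k w).
  by have := H k.+1; rewrite /= delta_cons; lia.
have ex : exists k, delta (take k w) < 0.
  by exists (size w); rewrite take_size; lia.
(* [k.+1] is the length of the shortest prefix of negative balance in the tail [w]: its first [k]
   letters form [u], and the letter at position [k] is the [b] closing the initial [a]. *)
case: (ex_minnP ex) => -[|k] dk mink; first by rewrite take0 in dk.
have kw : (k < size w)%N.
  rewrite ltnNge; apply/negP => wk.
  have := mink k; rewrite ltnn take_oversize //.
  by move: dk; rewrite take_oversize; [move=> dk /(_ dk) | exact: leqW].
have pos j : (j <= k)%N -> 0 <= delta (take j w).
  by move=> jk; rewrite leNgt; apply/negP => /mink; rewrite ltnNge jk.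
move: dk; rewrite (take_nth false kw) -cats1 !deltaE addr0 => dk.
have uk := pos k (leqnn _).
have wE : w = take k w ++ nth false w k :: drop k.+1 w.
  by rewrite -drop_nth // cat_take_drop.
case nthE: (nth false w k) dk wE => dk wE; first lia.
have u0 : delta (take k w) = 0 by lia.
exists (take k w), (drop k.+1 w); split; first by rewrite -wE.
- apply/dyckP; split=> // j; case: (leqP j k) => jk; first by rewrite take_takel ?pos.
  by rewrite take_taker ?u0 // ltnW.
- apply/dyckP; split.
    by move: d; rewrite {1}wE !deltaE; lia.
  move=> j; have := Hw (k.+1 + j)%N.
  by rewrite takeD (take_nth false kw) -cats1 nthE !deltaE u0; lia.
Qed.

Lemma dyck_wrap u v : dyck u -> dyck v -> dyck (true :: u ++ false :: v).
Proof.
move=> /dyckP[u0 pu] /dyckP[v0 pv]; apply/dyckP; rewrite !deltaE u0 v0; split=> //.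
case=> [|k] //=; rewrite take_cat delta_cons; case: ifP => _; first by have := pu k; lia.
case: (_ - _)%N => [|j] /=; rewrite !deltaE u0 //; have := pv j; lia.
Qed.

(** If [u] were strictly shorter than [u'], then [u] followed by [b] would be a prefix of [u'] of
    balance -1. *)
Lemma first_return_uniq u v u' v' : dyck u -> dyck u' ->
  u ++ false :: v = u' ++ false :: v' -> u = u' /\ v = v'.
Proof.
wlog le_uu' : u v u' v' / (size u <= size u')%N.
  move=> W du du' e; case: (leqP (size u) (size u')) => le; first exact: W le du du' e.
  by case: (W u' v' u v (ltnW le) du' du (esym e)) => -> ->.
move=> /dyckP[u0 _] /dyckP[_ pu'] e.
move: le_uu'; rewrite leq_eqVlt => /orP[/eqP se|lt].
  have /eqP := e; rewrite eqseq_cat // eqseq_cons eqxx /=.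
  by case/andP=> /eqP -> /eqP ->.
have := pu' (size u).+1.
have -> : take (size u).+1 u' = u ++ [:: false].
  have <- : take (size u).+1 (u' ++ false :: v') = take (size u).+1 u'.
    by rewrite takel_cat.
  by rewrite -e take_cat ltnNge leqnSn /= subSnn /= take0.
by rewrite !deltaE u0.
Qed.

(** * The map [theta] and its target words *)

Lemma theta_nil : theta [::] = [::].
Proof. by rewrite /theta; case: pickP => // k; have := ltn_ord k; rewrite ltn0. Qed.

Lemma theta_wrap u v : dyck u -> dyck v ->
  theta (true :: u ++ false :: v) = v ++ [:: true; false] ++ u.
Proof.
move=> du dv; rewrite /theta; case: pickP => [k /= /and3P[dk _ /eqP[e]]|].
  by have [<- <-] := first_return_uniq du dk e.
have uw : (size u < size (true :: u ++ false :: v))%N.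
  by rewrite /= size_cat; lia.
move/(_ (Ordinal uw)) => /=.
rewrite take_size_cat // drop_cat ltnNge leqnSn /= subSnn /= drop0.
by rewrite du dv eqxx.
Qed.

Lemma hts_wrap c u v : dyck u ->
  hts c (true :: u ++ false :: v) = c :: hts (c + 1) u ++ hts c v.
Proof. by move=> /dyckP[u0 _] /=; rewrite hts_cat /= u0 addr0 addrK. Qed.

Lemma dyck_theta w : dyck w -> dyck (theta w).
Proof.
case: (eqVneq w [::]) => [->|w0 dw]; first by rewrite theta_nil.
have [u [v [-> du dv]]] := first_return dw w0.
rewrite theta_wrap //; apply: dyck_cat => //.
by apply: (@dyck_wrap [::] u) => //; apply/dyckP; rewrite delta_nil.
Qed.

Lemma size_theta w : dyck w -> size (theta w) = size w.
Proof.
case: (eqVneq w [::]) => [->|w0 dw]; first by rewrite theta_nil.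
have [u [v [-> du dv]]] := first_return dw w0.
by rewrite theta_wrap // size_cat /= size_cat /=; lia.
Qed.

Lemma hts_abpow p : hts 0 (abpow p) = nseq p 0.
Proof. by elim: p => [|p IH] //=; rewrite add0r subrr IH. Qed.

Lemma hts0_abpow w : dyck w -> all (pred1 0) (hts 0 w) -> w = abpow (size w)./2.
Proof.
have [n] := ubnP (size w); elim: n w => // n IH w lt dw.
case: (eqVneq w [::]) => [->|w0] //.
have [u [v [wE du dv]]] := first_return dw w0.
rewrite wE hts_wrap // /= all_cat => /andP[hu hv].
(* The heights of [u] are nonnegative and occur in [w] raised by one, so none of them can be 0
   there. *)
have u0 : u = [::].
  apply: dyck_hts_nil => //; have := dyck_hts_ge0 du.
  move: hu; rewrite hts_shift; case: (hts 0 u) => //= y s /andP[/eqP y1 _] /andP[y0 _]; lia.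
rewrite u0 /= {1}(IH v) //; by move: lt; rewrite wE u0 /=; lia.
Qed.

(** ** The potential *)

(** The potential, with [x] the last maximum of the heights. The peak itself would contribute
    [x - x = 0] and is left out. *)
Definition peak_cost (s1 : seq int) (x : int) (s2 : seq int) : int :=
  \sum_(y <- s1) (x - y) + \sum_(y <- s2) (x - 1 - y).

Definition last_max (s1 : seq int) (x : int) (s2 : seq int) : bool :=
  all (fun y => y <= x) s1 && all (fun y => y < x) s2.

Definition has_cost (s : seq int) (c : int) : Prop :=
  exists s1 x s2, [/\ s = s1 ++ x :: s2, last_max s1 x s2 & c = peak_cost s1 x s2].

Lemma last_max_exists (s : seq int) : s != [::] ->
  exists s1 x s2, s = s1 ++ x :: s2 /\ last_max s1 x s2.
Proof.
elim: s => // y s IH _; case: (eqVneq s [::]) => [->|s0]; first by exists [::], y, [::].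
have [s1 [x [s2 [sE /andP[h1 h2]]]]] := IH s0.
case: (lerP y x) => yx; first by exists (y :: s1), x, s2; rewrite sE /last_max /= yx h1 h2.
exists [::], y, s; split=> //; rewrite /last_max /= sE all_cat /= yx.
apply/andP; split; first by apply: sub_all h1 => z /le_lt_trans; apply.
by apply: sub_all h2 => z /lt_trans; apply.
Qed.

Lemma peak_cost_ge0 s1 x s2 : last_max s1 x s2 -> 0 <= peak_cost s1 x s2.
Proof.
case/andP=> /allP h1 /allP h2; rewrite /peak_cost !big_seq.
by apply: addr_ge0; apply: sumr_ge0 => y; [move/h1|move/h2]; lia.
Qed.

Lemma cost_ge0 s c : has_cost s c -> 0 <= c.
Proof. by case=> s1 [x [s2 [_ lm ->]]]; exact: peak_cost_ge0. Qed.

Lemma cost_nseq p c : has_cost (nseq p 0) c -> c = 0.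
Proof.
case=> s1 [x [s2 [e /andP[_ h2] ->]]].
have : all (pred1 0) (s1 ++ x :: s2) by rewrite -e all_pred1_nseq.
rewrite all_cat /= => /and3P[/allP z1 /eqP x0 z2].
have -> : s2 = [::].
  case: s2 h2 z2 {e} => //= y s2 /andP[yx _] /andP[/eqP y0 _]; lia.
rewrite /peak_cost big_nil addr0 big_seq big1 // => y /z1 /eqP; lia.
Qed.

(** Decides whether the peak [x] of a concatenation lies in its first or its second block. *)
Lemma cat_eq_cat_cons (T : Type) (s t s1 s2 : seq T) x :
  s ++ t = s1 ++ x :: s2 ->
  (exists2 r, s = s1 ++ x :: r & s2 = r ++ t) \/
  (exists2 r, s1 = s ++ r & t = r ++ x :: s2).
Proof.
elim: s s1 => [|y s IH] [|z s1] /=; try by right; eexists.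
  by case=> <- <-; left; exists s.
case=> <- /IH[[r -> ->]|[r -> ->]]; first by left; exists r.
by right; exists r.
Qed.

(** If the maximum is at most 0, all heights vanish. Otherwise only the first height, 0, changes its
    contribution, from [x] to [x - 1]; those of [u] and [v] keep theirs, wherever the peak lies. *)
Lemma cost_theta w c : dyck w -> w != [::] -> has_cost (hts 0 w) c ->
  w = abpow (size w)./2 \/ has_cost (hts 0 (theta w)) (c - 1).
Proof.
move=> dw w0 [s1 [x [s2 [e lm ->]]]]; have /andP[h1 h2] := lm.
case: (lerP x 0) => x0.
  left; apply: hts0_abpow => //; have := dyck_hts_ge0 dw; rewrite e !all_cat /=.
  case/and3P=> p1 px p2; apply/and3P; split; last 2 first.
  - by apply/eqP; lia.
  - by apply/allP => y ys; move/allP: h2 => /(_ y ys); move/allP: p2 => /(_ y ys) /=; lia.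
  - by apply/allP => y ys; move/allP: h1 => /(_ y ys); move/allP: p1 => /(_ y ys) /=; lia.
right; have [u [v [wE du dv]]] := first_return dw w0.
rewrite wE theta_wrap // hts_cat (eqP (_ : delta v == 0)); last by case/dyckP: dv => ->.
rewrite /= addr0 addrK; move: e; rewrite wE hts_wrap // hts_shift.
(* The first height is 0 and [x] is positive, so the peak comes later. *)
case: s1 h1 lm => [|z s1] /= h1 lm; first by case=> x0'; move: x0; rewrite -x0' ltxx.
case=> z0 e; subst z; case/andP: h1 => _ h1.
case: (cat_eq_cat_cons e) => [[r hu s2E]|[r s1E hv]].
(* Peak in [u]: it drops to [x - 1] together with the heights of [u]. Those of [v] pass from after
   the peak to before it, and [x - 1 - y] is their contribution both times. *)
- have {}hu : hts 0 u = [seq y - 1 | y <- s1] ++ (x - 1) :: [seq y - 1 | y <- r].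
    rewrite -(map_id (hts 0 u)) -[RHS](map_cat _ s1 (x :: r)) -hu -map_comp.
    by apply: eq_map => y /=; rewrite addrK.
  subst s2; move: h2; rewrite all_cat => /andP[hr hv].
  exists (hts 0 v ++ 0 :: [seq y - 1 | y <- s1]), (x - 1), [seq y - 1 | y <- r].
  split; first by rewrite hu -catA.
    rewrite /last_max all_cat /= !all_map.
    apply/andP; split; last by apply: sub_all hr => y /=; lia.
    apply/and3P; split; [by apply: sub_all hv => y /=; lia | lia |].
    by apply: sub_all h1 => y /=; lia.
  rewrite /peak_cost !(big_cat, big_cons, big_map) /=.
  have -> : \sum_(y <- s1) (x - 1 - (y - 1)) = \sum_(y <- s1) (x - y).
    by apply: eq_bigr => y _; ring.
  have -> : \sum_(y <- r) (x - 1 - 1 - (y - 1)) = \sum_(y <- r) (x - 1 - y).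
    by apply: eq_bigr => y _; ring.
  ring.
(* Peak in [v]: it stays at [x]. The heights of [u] drop by one and pass behind it, and
   [x - (y + 1)] equals [x - 1 - y]. *)
- subst s1; move: h1; rewrite all_cat all_map => /andP[hu hr].
  exists r, x, (s2 ++ 0 :: hts 0 u).
  split; first by rewrite hv -catA.
    rewrite /last_max hr /= all_cat h2 /= x0.
    by apply: sub_all hu => y /=; lia.
  rewrite /peak_cost !(big_cat, big_cons, big_map) /=.
  have -> : \sum_(y <- hts 0 u) (x - (y + 1)) = \sum_(y <- hts 0 u) (x - 1 - y).
    by apply: eq_bigr => y _; ring.
  ring.
Qed.

(** The potential counts the remaining steps: it is 0 on [abpow], so that word is not reached while
    the potential is positive, and at 0 a further drop would make it negative. *)
Lemma cost_prerank r w : dyck w -> w != [::] -> has_cost (hts 0 w) r%:Z ->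
  dyck_prerank w r.
Proof.
elim: r w => [|r IH] w dw w0 cw.
  split=> //; case: (cost_theta dw w0 cw) => // /cost_ge0; by rewrite sub0r oppr_ge0 ler10.
have [wE|ct] := cost_theta dw w0 cw.
  by move: cw; rewrite wE hts_abpow => /cost_nseq.
have w0' : theta w != [::] by rewrite -size_eq0 size_theta // size_eq0.
have cr : has_cost (hts 0 (theta w)) r%:Z.
  by move: ct; rewrite (_ : r.+1%:Z - 1 = r%:Z) //; lia.
have [e mink] := IH _ (dyck_theta dw) w0' cr.
rewrite size_theta // in e mink.
split; first by rewrite iterSr.
case=> [|j]; last by rewrite iterSr => /mink.
move=> /= wE; move: cw; rewrite wE hts_abpow => /cost_nseq; lia.
Qed.

(** ** The map Phi *)

(** Lifts a splitting of the heights to the splitting of the word at the corresponding [a]. *)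
Lemma hts_eq_cat_cons c w s1 x s2 : hts c w = s1 ++ x :: s2 ->
  exists u v, [/\ w = u ++ true :: v, hts c u = s1, x = c + delta u &
                  hts (c + delta u + 1) v = s2].
Proof.
elim: w c s1 => [|[] w IH] c s1 /=; first by case: s1.
- case: s1 => [|y s1] /= [<-].
    by move=> <-; exists [::], w; rewrite delta_nil addr0.
  move=> /IH[u [v [-> <- -> <-]]]; exists (true :: u), v.
  by rewrite add_delta_cons.
- move=> /IH[u [v [-> <- -> <-]]]; exists (false :: u), v.
  by rewrite add_delta_cons.
Qed.

Lemma last_maxP (s1 : seq int) x s2 i : last_max s1 x s2 -> (i < size (s1 ++ x :: s2))%N ->
  (s1 ++ x :: s2)`_i <= x /\ ((size s1 < i)%N -> (s1 ++ x :: s2)`_i < x).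
Proof.
case/andP=> /allP h1 /allP h2; rewrite size_cat nth_cat /= => lti.
case: ltngtP => [lt|gt|->]; last by rewrite subnn.
- by split=> //; apply/h1/mem_nth.
- case iE: (i - size s1)%N => [|j] /=; first lia.
  have lt : nth 0 s2 j < x.
    by apply: h2; apply: mem_nth; rewrite -ltnS -iE ltn_subLR // ltnW.
  by split=> // ; apply: ltW.
Qed.

Lemma Phi_split u v : last_max (hts 0 u) (delta u) (hts (delta u + 1) v) ->
  Phi (u ++ true :: v) = rev (rcons u true) ++ rev v.
Proof.
move=> lm; set w := u ++ true :: v.
have hE : heights w = hts 0 u ++ delta u :: hts (delta u + 1) v.
  by rewrite heightsE hts_cat add0r.
set k := size (hts 0 u).
have kw : (k < size (heights w))%N by rewrite hE size_cat /=; lia.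
have hk : (heights w)`_k = delta u by rewrite hE nth_cat ltnn subnn.
have H i : (i < size (heights w))%N ->
    (heights w)`_i <= delta u /\ ((k < i)%N -> (heights w)`_i < delta u).
  by rewrite hE; apply: last_maxP.
rewrite /Phi; case: pickP => [m /forallP pm|]; last first.
  move/(_ (Ordinal kw)) => /negbT /negP[]; apply/forallP => j /=.
  have [h1 h2] := H j (ltn_ord j).
  by rewrite hk h1 /=; apply/implyP.
have [m1 m2] := H m (ltn_ord m).
have /andP[/= k1 /implyP k2] := pm (Ordinal kw); rewrite hk in k1 k2.
(* Both indices are last maxima: whichever comes first would have a strictly larger height than the
   other, against its maximality. *)
have mk : m = k :> nat.
  case: (ltngtP m k) => // [/k2|/m2]; first by rewrite ltNge m1.
  by rewrite ltNge k1.
have -> : nth 0%N (apos w) m = size u.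
  rewrite mk /w apos_cat apos_cons nth_cat size_apos ltnn subnn /=; lia.
by rewrite /w -cat_rcons -(size_rcons u true) take_size_cat // drop_size_cat.
Qed.

(** Two uses of [hts_rev]: the first block starts at 0 and has balance [delta u + 1], the second
    starts at [delta u + 1] and has balance [- delta u - 2]. *)
Lemma hts_Phi u v : delta (u ++ true :: v) = -1 ->
  hts 0 (rev (rcons u true) ++ rev v) =
  rev [seq delta u - y | y <- rcons (hts 0 u) (delta u)] ++
  rev [seq delta u - 1 - y | y <- hts (delta u + 1) v].
Proof.
move=> dw; rewrite hts_cat !hts_rev delta_rev -cats1 hts_cat -cats1 !deltaE /=.
rewrite !add0r addr0; congr (rev _ ++ rev _); first by apply: eq_map => y; ring.
move: dw; rewrite !deltaE => dw.
have -> : delta v = - delta u - 2 by lia.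
by apply: eq_map => y; ring.
Qed.

Lemma D_split n w : (2 <= n)%N -> w \in D n ->
  exists u v, w = u ++ true :: v /\
    last_max (hts 0 u) (delta u) (hts (delta u + 1) v).
Proof.
move=> n2 /(D_P _ (ltnW n2))[_ cw _].
have h0 : hts 0 w != [::].
  by rewrite -size_eq0 size_hts cw; lia.
have [s1 [x [s2 [e lm]]]] := last_max_exists h0.
have [u [v [-> hu xE hv]]] := hts_eq_cat_cons e.
by rewrite !add0r in xE hv; exists u, v; rewrite hu hv -xE.
Qed.

Lemma Phi_D n w : (2 <= n)%N -> w \in D n -> Phi w \in D n /\ Phi (Phi w) = w.
Proof.
move=> n2 wD; have n0 := ltnW n2.
have [u [v [wE lm]]] := D_split n2 wD.
have /(D_P _ n0)[dw cw pw] := wD.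
have hge : all (fun y => 0 <= y) (hts 0 w).
  by apply: hts_ge0 => k kw; rewrite add0r; apply: pw.
rewrite wE in dw cw pw hge *; rewrite (Phi_split lm).
have h0 : 0 <= delta u.
  by have := pw (size u); rewrite take_size_cat // size_cat /=; apply; lia.
have dv : delta v = - delta u - 2 by move: dw; rewrite !deltaE; lia.
have /andP[h1 h2] := lm.
split.
  apply/(D_P _ n0); split.
  - by rewrite delta_cat !delta_rev -cats1 -dw !deltaE; ring.
  - by rewrite -cw count_cat !count_rev -cats1 !count_cat /=; lia.
  - move=> k; rewrite size_cat !size_rev => kw.
    rewrite take_cat size_rev; case: ltnP => ku.
      rewrite delta_take_rev -[in delta (rcons u true)]cats1 !deltaE.
      (* Inside the first reversed block a prefix has balance [delta u + 1] minus that of a prefix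
         of [rcons u true], which is at most [delta u + 1]. *)
      have hu : all (fun y => y < delta u + 1) (hts 0 (rcons u true)).
        rewrite -cats1 hts_cat all_cat /= add0r ltrDl ltr01 !andbT.
        by apply: sub_all h1 => y; lia.
      have := delta_le_hts (addr_ge0 h0 ler01) hu (size (rcons u true) - k).
      by rewrite add0r; lia.
    (* An [a] opening [v] would lie above the maximum, and [v] is nonempty since its balance is
       negative. *)
    have [v' vE] : exists v', v = false :: v'.
      case: (v) h2 dv => [|[] v'] /=; [by rewrite delta_nil; lia | | by exists v'].
      by rewrite ltNge lerDl ler01.
    rewrite delta_cat delta_rev delta_take_rev.
    (* The prefix is strict, so at least the initial [b] of [v] is left out; past that [b], the path
       of [w] never exceeds [delta u]. *)
    have [j ->] : exists j, (size v - (k - size (rcons u true)) = j.+1)%N.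
      by exists (size v - (k - size (rcons u true))).-1; lia.
    rewrite -cats1 !deltaE dv; move: h2; rewrite vE /= addrK delta_cons => h2.
    by have := delta_le_hts (lexx (delta u)) h2 j; lia.
(* The initial [a] of [w] ends the first reversed block. It is the last maximum of [Phi w], again at
   height [delta u], so [Phi] cuts at the same place. *)
have [u' uE] : exists u', rcons u true = true :: u'.
  case: (u) pw => [|[] u1] pw; [by exists [::] | by exists (rcons u1 true) |].
  have := pw 1%N; rewrite /= take0 size_cat addnS => /(_ isT).
  by rewrite delta_cons delta_nil.
have uE' : u ++ true :: v = true :: u' ++ v by rewrite -cat_rcons uE.
have du : delta u' = delta u.
  by have := congr1 delta uE; rewrite -cats1 !deltaE; lia.
rewrite uE rev_cons cat_rcons Phi_split ?delta_rev ?du; first by rewrite -rev_cons !revK.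
have gev : all (fun y => 0 <= y) (hts (delta u + 1) v).
  by move: hge; rewrite hts_cat all_cat add0r /= => /and3P[].
have geu' : all (fun y => 0 <= y + 1) (hts 0 u').
  move: hge; rewrite uE' /= hts_cat all_cat (hts_shift 0 1) => /andP[+ _].
  by rewrite all_map.
(* Maximality of the new peak amounts to nonnegativity of the heights of [w]. *)
rewrite /last_max !hts_rev !all_rev !all_map du dv; apply/andP; split.
- by apply: sub_all geu' => y /=; lia.
- by apply: sub_all gev => y /=; lia.
Qed.

(** ** The statistic dinv *)

Definition dinv_rel (x y : int) : bool := (x == y) || (y == x - 1).

Fixpoint dinv_seq (s : seq int) : nat :=
  if s is x :: s' then (count (dinv_rel x) s' + dinv_seq s')%N else 0%N.

Lemma dinvE w : dinv w = dinv_seq (heights w).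
Proof.
rewrite /dinv; set s := heights w.
transitivity (\sum_(i < size s) \sum_(j < size s)
                ((i < j) && dinv_rel s`_i s`_j : nat))%N.
  rewrite -sum1_card pair_bigA big_mkcond /=; apply: eq_bigr => -[i j] _.
  by rewrite inE /= /dinv_rel; case: ifP.
elim: s => [|x s IH] /=; first by rewrite big_ord0.
rewrite big_ord_recl big_ord_recl /= add0n -IH; congr (_ + _)%N.
  rewrite -sum1_count (big_nth 0) big_mkord [RHS]big_mkcond; apply: eq_bigr => j _.
  by rewrite add0n; case: dinv_rel.
by apply: eq_bigr => i _; rewrite big_ord_recl add0n.
Qed.

Lemma dinv_seq_cat s t :
  dinv_seq (s ++ t) =
  (dinv_seq s + dinv_seq t + \sum_(x <- s) count (dinv_rel x) t)%N.
Proof.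
elim: s => [|x s IH] /=; first by rewrite big_nil addn0.
by rewrite count_cat IH big_cons; lia.
Qed.

(** A pair [(x, y)] becomes [(c - y, c - x)], which preserves both equality and [y = x - 1]. *)
Lemma dinv_seq_rev (c : int) (s : seq int) : dinv_seq (rev [seq c - y | y <- s]) = dinv_seq s.
Proof.
elim: s => [|x s IH] //=.
rewrite rev_cons -cats1 dinv_seq_cat IH /= !addn0 addnC; congr (_ + _)%N.
rewrite (perm_big [seq c - y | y <- s]) ?perm_rev // big_map -sum1_count.
rewrite [RHS]big_mkcond; apply: eq_bigr => y _ /=.
rewrite addn0 /dinv_rel (_ : _ || _ = (x == y) || (y == x - 1)); first by case: ifP.
by apply/idP/idP; lia.
Qed.

(** A pair across the blocks keeps its order and becomes [(h - x, h - 1 - y)]: now [y = x - 1] gives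
    equality and [x = y] gives a descent by one. *)
Lemma dinv_seq_blocks (h : int) (s t : seq int) :
  dinv_seq (rev [seq h - y | y <- s] ++ rev [seq h - 1 - y | y <- t]) =
  dinv_seq (s ++ t).
Proof.
rewrite !dinv_seq_cat !dinv_seq_rev; congr (_ + _)%N.
rewrite (perm_big [seq h - y | y <- s]) ?perm_rev // big_map.
apply: eq_bigr => x _; rewrite count_rev count_map; apply: eq_count => y /=.
by rewrite /dinv_rel; apply/idP/idP; lia.
Qed.

Theorem proposition13 (n : nat) (hn : (2 <= n)%N) :
  (forall w : word, w \in D n -> Phi w \in D n /\ Phi (Phi w) = w) /\
  (forall w : word, w \in D n ->
     (exists r : nat, prerank w r /\ r%:Z = area (Phi w)) /\
     dinv w = dinv (Phi w)).
Proof.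
split=> [w|w wD]; first exact: Phi_D.
have [u [v [wE lm]]] := D_split hn wD.
have /(D_P _ (ltnW hn))[dw _ _] := wD.
have hw : hts 0 w = hts 0 u ++ delta u :: hts (delta u + 1) v.
  by rewrite wE hts_cat add0r.
have hPhi : heights (Phi w) =
    rev [seq delta u - y | y <- rcons (hts 0 u) (delta u)] ++
    rev [seq delta u - 1 - y | y <- hts (delta u + 1) v].
  by rewrite wE Phi_split // heightsE hts_Phi // -wE.
split; last by rewrite !dinvE hPhi dinv_seq_blocks heightsE hw cat_rcons.
have areaE : area (Phi w) = peak_cost (hts 0 u) (delta u) (hts (delta u + 1) v).
  rewrite /area hPhi big_cat -!map_rev !big_map /peak_cost.
  rewrite !(perm_big _ (introT permPl (perm_rev _))) /=.
  by rewrite -cats1 big_cat big_seq1 /= subrr addr0.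
have [w' w'E dw'] := D_rcons (ltnW hn) wD.
(* Removing the final [b] leaves the heights unchanged, so [w'] has the potential of [w]. *)
have hw' : hts 0 w' = hts 0 w by rewrite w'E -cats1 hts_cat cats0.
exists `|area (Phi w)|%N; have a0 := peak_cost_ge0 lm.
split; last by rewrite areaE; lia.
exists w'; split=> //; apply: cost_prerank => //.
  by apply/eqP => w'0; move: hw'; rewrite hw w'0; case: (hts 0 u).
exists (hts 0 u), (delta u), (hts (delta u + 1) v); split=> //; first by rewrite hw'.
by rewrite areaE; lia.
Qed.
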